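(* Let $a,b\in\mathbb{F}_2[z]\setminus\mathbb{F}_2$ be two distinct polynomials such that $\deg a+\deg b\le 7$. Let $\mathbf{u}(z)=(u_n(z))_{n\ge 0}$ be the $(a,b)$-Thue-Morse sequence. Then the continued fraction $\mathrm{CF}(\mathbf{u}(z))\in\mathbb{F}_2((1/z))$ is algebraic of degree $4$ over $\mathbb{F}_2(z)$.
   Context: For two distinct elements $a,b$ of an alphabet, the $(a,b)$-Thue-Morse sequence is the fixed point $s^\infty(a)$ (starting with $a$) of the substitution $s: a\mapsto ab,\ b\mapsto ba$. For a field $K$ and a sequence $\mathbf{a}(z)=(a_j(z))_{j\ge0}$ of polynomials in $K[z]\setminus K$, the continued fraction $$\mathrm{CF}(\mathbf{a}(z))=\cfrac{1}{a_0(z)+\cfrac{1}{a_1(z)+\cfrac{1}{a_2(z)+\cdots}}}$$ is the limit in $K((1/z))$ (which exists) of the finite continued fractions $$\mathrm{CF}_n(\mathbf{a}(z))=\cfrac{1}{a_0(z)+\cfrac{1}{a_1(z)+\cfrac{1}{\ddots+\cfrac{1}{a_n(z)}}}}\,.$$ Rational fractions are expanded in powers of $1/z$. *)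

(* Defs.v *)
From HB Require Import structures.
From mathcomp Require Import all_boot all_order all_algebra.
From mathcomp Require Import generic_quotient zify.
From mathcomp Require Import boolp classical_sets fsbigop.

Set Implicit Arguments.
Unset Strict Implicit.
Unset Printing Implicit Defensive.

Import Order.TTheory GRing.Theory Num.Theory.
Local Open Scope ring_scope.

Notation "x %:F" := (@FracField.tofrac _ x) : ring_scope.

Fact iota_index_iota n : iota 0 n = index_iota 0 n.
Proof. by rewrite /index_iota subn0. Qed.

Section ThueMorse.
Variables (T : eqType) (a b : T).

(* Letters other than a and b never occur in the words considered below. *)
Definition tm_subst (x : T) : seq T :=
  if x == a then [:: a; b] else [:: b; a].

Definition word_subst (w : seq T) : seq T := flatten (map tm_subst w).

(* The word word_subst^n (a) has length 2 ^ n > n and is a prefix of the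
   infinite fixed point, so that it determines the n-th letter. *)
Definition thue_morse (n : nat) : T := nth a (iter n word_subst [:: a]) n.

Lemma size_word_subst w : size (word_subst w) = (size w).*2.
Proof.
elim: w => //= x w IHw; rewrite /word_subst /= size_cat -/(word_subst w) IHw.
by rewrite /tm_subst; case: ifP.
Qed.

Lemma size_iter_word_subst n :
  size (iter n word_subst [:: a]) = (2 ^ n)%N.
Proof. by elim: n => //= n IHn; rewrite size_word_subst IHn expnS mul2n. Qed.

Lemma word_subst_cat v w :
  word_subst (v ++ w) = word_subst v ++ word_subst w.
Proof. by rewrite /word_subst map_cat flatten_cat. Qed.

Lemma iter_word_subst_prefix m n : (m <= n)%N ->
  exists w, iter n word_subst [:: a] = iter m word_subst [:: a] ++ w.
Proof.
have step k : exists w,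
    iter k.+1 word_subst [:: a] = iter k word_subst [:: a] ++ w.
  elim: k => [|k [w IHk]]; first by exists [:: b]; rewrite /= /word_subst /= /tm_subst eqxx.
  by exists (word_subst w); rewrite [LHS]iterS [in LHS]IHk word_subst_cat.
elim: n => [|n IHn]; first by rewrite leqn0 => /eqP->; exists [::].
rewrite leq_eqVlt => /orP[/eqP->|/IHn[w eqw]]; first by exists [::]; rewrite cats0.
by have [w' ->] := step n; exists (w ++ w'); rewrite eqw catA.
Qed.

Lemma thue_morseE m n : (n < 2 ^ m)%N ->
  thue_morse n = nth a (iter m word_subst [:: a]) n.
Proof.
move=> ltnm; have ltnn : (n < 2 ^ n)%N by apply: ltn_expl.
rewrite /thue_morse; case: (leqP m n) => [|/ltnW] /iter_word_subst_prefix[w ->].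
  by rewrite nth_cat size_iter_word_subst ltnm.
by rewrite nth_cat size_iter_word_subst ltnn.
Qed.

Lemma thue_morse0 : thue_morse 0 = a.
Proof. by []. Qed.

Lemma nth_word_subst w n : (n < size w)%N ->
  [:: nth a (word_subst w) n.*2; nth a (word_subst w) n.*2.+1]
  = tm_subst (nth a w n).
Proof.
elim: w n => // x w IHw [|n] /= ltn.
  by rewrite /word_subst /= /tm_subst; case: ifP.
rewrite -(IHw n) // /word_subst /= /tm_subst; by case: ifP.
Qed.

Lemma thue_morse_fixed n :
  [:: thue_morse n.*2; thue_morse n.*2.+1] = tm_subst (thue_morse n).
Proof.
have ltnn : (n < 2 ^ n)%N by apply: ltn_expl.
rewrite (@thue_morseE n.+1 n.*2) ?(@thue_morseE n.+1 n.*2.+1) ?expnS; [|lia..].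
by rewrite iterS nth_word_subst // size_iter_word_subst.
Qed.

End ThueMorse.

Section LaurentDef.
Variable K : fieldType.

(* K((1/z)): [lcoef x i] is the coefficient of z ^ i in x. *)
Record laurent := Laurent {
  lcoef : int -> K;
  lcoef_bounded : exists N : int, forall i : int, N < i -> lcoef i = 0 }.

Lemma laurentP x y : lcoef x =1 lcoef y <-> x = y.
Proof.
split=> [|->//]; case: x y => [f Hf] [g Hg] /= /funext efg.
by case: _ / efg in Hg *; congr Laurent; apply: Prop_irrelevance.
Qed.

HB.instance Definition _ := gen_eqMixin laurent.
HB.instance Definition _ := gen_choiceMixin laurent.

Definition lbound (x : laurent) (N : int) := forall i, N < i -> lcoef x i = 0.

Lemma lboundW x N M : N <= M -> lbound x N -> lbound x M.
Proof. by move=> leNM xN i /(le_lt_trans leNM)/xN. Qed.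

Lemma ex_lbound2 x y : exists N, lbound x N /\ lbound y N.
Proof.
have [N xN] := lcoef_bounded x; have [M yM] := lcoef_bounded y.
by exists (Num.max N M); split=> i; rewrite gt_max => /andP[]; auto.
Qed.

Lemma lext B x y : lbound x B -> lbound y B ->
  (forall m : nat, lcoef x (B - m%:Z) = lcoef y (B - m%:Z)) -> x = y.
Proof.
move=> xB yB eqxy; apply/laurentP => i.
have [ltBi|leiB] := ltP B i; first by rewrite xB ?yB.
by have -> : i = B - (`|(B - i)%R|%N)%:Z by lia.
Qed.

Fact lzero_bounded : exists N : int, forall i, N < i -> (0 : K) = 0.
Proof. by exists 0. Qed.
Definition lzero := @Laurent (fun=> 0) lzero_bounded.

Fact lone_bounded : exists N : int, forall i, N < i -> (i == 0)%:R = 0 :> K.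
Proof. by exists 0 => i i_gt0; rewrite gt_eqF. Qed.
Definition lone := Laurent lone_bounded.

Fact lopp_bounded x :
  exists N : int, forall i, N < i -> - lcoef x i = 0.
Proof. by have [N xN] := lcoef_bounded x; exists N => i /xN->; rewrite oppr0. Qed.
Definition lopp x := Laurent (lopp_bounded x).

Fact ladd_bounded x y :
  exists N : int, forall i, N < i -> lcoef x i + lcoef y i = 0.
Proof.
by have [N [xN yN]] := ex_lbound2 x y; exists N => i ltNi; rewrite xN ?yN ?addr0.
Qed.
Definition ladd x y := Laurent (ladd_bounded x y).

(* The sum ranges over all integers, but only finitely many terms are
   nonzero. *)
Definition lmul_coef x y (n : int) : K :=
  \sum_(i \in [set: int]) lcoef x i * lcoef y (n - i).

Lemma lmul_coefE x y N M (m : nat) : lbound x N -> lbound y M ->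
  lmul_coef x y (N + M - m%:Z) =
  \sum_(k < m.+1) lcoef x (N - k%:Z) * lcoef y (M - (m - k)%N%:Z).
Proof.
move=> xN yM; rewrite /lmul_coef (fsbigE [seq N - k%:Z | k <- iota 0 m.+1]).
- rewrite big_map iota_index_iota big_mkord big_mkcond /=.
  apply: eq_bigr => k _; rewrite in_setT; congr (_ * lcoef y _).
  by have := ltn_ord k; lia.
- by rewrite map_inj_uniq ?iota_uniq // => i j; lia.
- by [].
move=> i _ /mapP iNm; have [ltNi|leiN] := ltP N i; first by rewrite xN ?mul0r.
rewrite [lcoef y _]yM ?mulr0 //.
rewrite ltNge; apply/negP => le_M; case: iNm.
by exists (`|(N - i)%R|%N); rewrite ?mem_iota; lia.
Qed.

Lemma lmul_coef0 x y N M i : lbound x N -> lbound y M -> N + M < i ->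
  lmul_coef x y i = 0.
Proof.
move=> xN yM ltNMi; apply: fsbig1 => j _.
have [ltNj|lejN] := ltP N j; first by rewrite xN ?mul0r.
by rewrite [lcoef y _]yM ?mulr0 //; lia.
Qed.

Fact lmul_bounded x y :
  exists N : int, forall i, N < i -> lmul_coef x y i = 0.
Proof.
have [N [xN yN]] := ex_lbound2 x y.
by exists (N + N) => i; apply: lmul_coef0.
Qed.
Definition lmul x y := Laurent (lmul_bounded x y).

Fact laddA : associative ladd.
Proof. by move=> x y z; apply/laurentP => i /=; rewrite addrA. Qed.
Fact laddC : commutative ladd.
Proof. by move=> x y; apply/laurentP => i /=; rewrite addrC. Qed.
Fact ladd0 : left_id lzero ladd.
Proof. by move=> x; apply/laurentP => i /=; rewrite add0r. Qed.
Fact laddN : left_inverse lzero lopp ladd.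
Proof. by move=> x; apply/laurentP => i /=; rewrite addNr. Qed.

HB.instance Definition _ := GRing.isZmodule.Build laurent laddA laddC ladd0 laddN.

Let tr (x : laurent) (N : int) (m : nat) : {poly K} :=
  \poly_(k < m.+1) lcoef x (N - k%:Z).

Let coef_tr x N m k : (k <= m)%N -> (tr x N m)`_k = lcoef x (N - k%:Z).
Proof. by move=> lekm; rewrite coef_poly ltnS lekm. Qed.

Let lmul_tr x y N M m k : lbound x N -> lbound y M -> (k <= m)%N ->
  lcoef (lmul x y) (N + M - k%:Z) = (tr x N m * tr y M m)`_k.
Proof.
move=> xN yM lekm; rewrite /= (lmul_coefE _ xN yM) coefM; apply: eq_bigr => i _.
by have := ltn_ord i => ltik; rewrite !coef_tr //; lia.
Qed.

Lemma lbound_mul x y N M : lbound x N -> lbound y M -> lbound (lmul x y) (N + M).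
Proof. by move=> xN yM i; apply: lmul_coef0. Qed.

Fact lmulA : associative lmul.
Proof.
move=> x y z.
have [N xN] := lcoef_bounded x; have [M yM] := lcoef_bounded y.
have [P zP] := lcoef_bounded z; rewrite -/(lbound _ _) in xN yM zP.
have xyB := lbound_mul xN yM; have yzB := lbound_mul yM zP.
apply: (@lext (N + M + P)); first by rewrite -addrA; apply: lbound_mul.
  exact: lbound_mul.
move=> m; rewrite -[in LHS](addrA N M P).
rewrite (@lmul_tr x _ _ _ m) // (@lmul_tr _ z _ _ m) //.
transitivity ((tr x N m * (tr y M m * tr z P m))`_m).
  rewrite !coefM; apply: eq_bigr => i _; congr (_ * _).
  by rewrite coef_tr ?leq_subr // (@lmul_tr _ _ _ _ m) ?leq_subr.
rewrite mulrA !coefM; apply: eq_bigr => i _; congr (_ * _).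
have leim : (i <= m)%N by rewrite -ltnS.
by rewrite coef_tr // (@lmul_tr _ _ _ _ m).
Qed.

Fact lmulC : commutative lmul.
Proof.
move=> x y; have [N [xN yN]] := ex_lbound2 x y.
apply: (@lext (N + N)) => [||m]; [exact: lbound_mul..|].
by rewrite !(@lmul_tr _ _ _ _ m) // mulrC.
Qed.

Fact lmulDl : left_distributive lmul ladd.
Proof.
move=> x y z; have [N [xN yN]] := ex_lbound2 x y.
have [M zM] := lcoef_bounded z; rewrite -/(lbound _ _) in zM.
have xyN : lbound (ladd x y) N by move=> i Ni /=; rewrite xN ?yN ?addr0.
apply: (@lext (N + M)) => [|i NMi|m]; first exact: lbound_mul.
  by rewrite /= !(lmul_coef0 _ zM NMi) ?addr0.
transitivity (lcoef (lmul x z) (N + M - m%:Z) + lcoef (lmul y z) (N + M - m%:Z)).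
  2: by [].
rewrite !(@lmul_tr _ _ _ _ m) // -coefD -mulrDl.
congr (polyseq (_ * _))`_m; apply/polyP => k; rewrite coefD !coef_poly /=.
by case: ifP; rewrite ?addr0.
Qed.

Fact lmul1 : left_id lone lmul.
Proof.
move=> x; have [N xN] := lcoef_bounded x; rewrite -/(lbound _ _) in xN.
have oneB : lbound lone 0 by move=> i i_gt0; rewrite /= gt_eqF.
apply: (@lext N) => [||m] //; first by rewrite -[N]add0r; apply: lbound_mul.
rewrite -{1}[N]add0r /= (lmul_coefE _ oneB xN) big_ord_recl big1 => [|i _].
  by rewrite addr0 subn0 mul1r.
by rewrite (_ : lcoef lone _ = 0) ?mul0r.
Qed.

Fact lone_neq0 : lone != 0.
Proof. by apply/eqP => /laurentP/(_ 0)/eqP; rewrite /= oner_eq0. Qed.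

HB.instance Definition _ :=
  GRing.Zmodule_isComNzRing.Build laurent lmulA lmulC lmul1 lmulDl lone_neq0.

(* Coefficients of the inverse of a power series with constant term u 0. *)
Fixpoint inv_coefs (u : nat -> K) (m : nat) : seq K :=
  if m is m'.+1 then
    let v := inv_coefs u m' in
    rcons v ((u 0%N)^-1 * ((m' == 0%N)%:R - \sum_(k < m') u k.+1 * v`_(m' - k.+1)))
  else [::].

Let size_inv_coefs u m : size (inv_coefs u m) = m.
Proof. by elim: m => //= m IHm; rewrite size_rcons IHm. Qed.

Let inv_coef u m := (inv_coefs u m.+1)`_m.

Let nth_inv_coefs u m k : (k < m)%N -> (inv_coefs u m)`_k = inv_coef u k.
Proof.
elim: m => // m IHm; rewrite ltnS leq_eqVlt => /orP[/eqP->//|ltkm].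
by rewrite /= nth_rcons size_inv_coefs ltkm IHm.
Qed.

Let inv_coefP u m : u 0%N != 0 ->
  \sum_(k < m.+1) u k * inv_coef u (m - k)%N = (m == 0%N)%:R.
Proof.
move=> u0; rewrite big_ord_recl subn0 {1}/inv_coef /= nth_rcons size_inv_coefs ltnn eqxx.
rewrite mulrA divff // mul1r -addrA [X in _ + X]addrC (_ : \sum_(i < m) _ = \sum_(i < m) u i.+1 * (inv_coefs u m)`_(m - i.+1)) ?subrr ?addr0 //.
apply: eq_bigr => i _; rewrite nth_inv_coefs //=.
by have := ltn_ord i; lia.
Qed.

Let lseries_coef (N : int) (v : nat -> K) (i : int) : K :=
  if N - i is Posz k then v k else 0.

Fact lseries_bounded N v :
  exists M : int, forall i, M < i -> lseries_coef N v i = 0.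
Proof.
exists N => i; rewrite /lseries_coef.
by case E : (N - i) => [k|k] //; lia.
Qed.

Let lseries N v := Laurent (lseries_bounded N v).

Lemma lunitP (x : laurent) : x != 0 -> exists y, y * x = 1.
Proof.
move=> x0; have [N xN] := lcoef_bounded x; rewrite -/(lbound _ _) in xN.
have exk : exists k : nat, lcoef x (N - k%:Z) != 0.
  apply: contrapT => nex; case/eqP: x0; apply: (@lext N) => // m.
  by apply/eqP/negPn/negP => xm; case: nex; exists m.
case: (ex_minnP exk) => k xk kmin; pose d := N - k%:Z.
have xd : lbound x d.
  move=> i ltdi; have [ltNi|leiN] := ltP N i; first exact: xN.
  apply/eqP/negPn/negP => xi; have := kmin `|(N - i)%R|%N.
  have -> : N - `|(N - i)%R|%N%:Z = i by lia.
  by move/(_ xi); lia.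
pose u m := lcoef x (d - m%:Z).
have yB : lbound (lseries (- d) (inv_coef u)) (- d).
  by move=> i; rewrite /= /lseries_coef; case E : (- d - i) => [l|l] //; lia.
exists (lseries (- d) (inv_coef u)); rewrite mulrC.
apply: (@lext (d - d)); first exact: lbound_mul.
  by rewrite subrr => i i_gt0; rewrite /= gt_eqF.
move=> m; rewrite [LHS](lmul_coefE _ xd yB).
transitivity ((m == 0%N)%:R : K); last by rewrite /=; congr (_%:R); lia.
rewrite -(@inv_coefP u) ?subr0 /u; last by rewrite subr0.
apply: eq_bigr => i _; congr (_ * _).
by rewrite /= /lseries_coef (_ : _ - _ = Posz (m - i)%N) //; lia.
Qed.

Definition linv (x : laurent) : laurent :=
  if x == 0 then 0 else xget 0 [set y | y * x = 1].

Fact lmulVx (x : laurent) : x != 0 -> linv x * x = 1.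
Proof. by move=> x0; rewrite /linv (negPf x0); apply: (xgetPex 0 (lunitP x0)). Qed.
Fact linv0 : linv 0 = 0.
Proof. by rewrite /linv eqxx. Qed.

HB.instance Definition _ := GRing.ComNzRing_isField.Build laurent lmulVx linv0.

(* Convergence for the (1/z)-adic absolute value: u n - l eventually has all
   its terms of degree < k, for every k. *)
Definition lcvg (u : nat -> laurent) (l : laurent) :=
  forall k : int, exists n0 : nat, forall n, (n0 <= n)%N ->
  forall i, k <= i -> lcoef (u n) i = lcoef l i.

Lemma lcvg_unique u l l' : lcvg u l -> lcvg u l' -> l = l'.
Proof.
move=> ul ul'; apply/laurentP => i.
have [n le_n] := ul i; have [n' le_n'] := ul' i.
by rewrite -(le_n (maxn n n')) ?leq_maxl // (le_n' (maxn n n')) ?leq_maxr.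
Qed.

(* The value is 0 if u does not converge; as 0 has degree 1 over any subfield,
   a limit of degree at least 2 is a genuine one. *)
Definition llim (u : nat -> laurent) : laurent := xget 0 [set l | lcvg u l].

Lemma lcvg_lim u l : lcvg u l -> llim u = l.
Proof. by move=> ul; apply: xget_unique => // l' /lcvg_unique; apply. Qed.

Definition lpoly_coef (p : {poly K}) (i : int) : K :=
  if i is Posz k then p`_k else 0.

Fact lpoly_bounded p :
  exists N : int, forall i, N < i -> lpoly_coef p i = 0.
Proof.
by exists (size p)%:Z => -[k|k] //= lt_pk; rewrite nth_default //; lia.
Qed.
Definition lpoly p := Laurent (lpoly_bounded p).

Fact lpoly_is_zmod_morphism : zmod_morphism lpoly.
Proof.
by move=> p q; apply/laurentP => -[k|k] /=; rewrite ?subr0 // coefB.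
Qed.

Fact lpoly_is_monoid_morphism : monoid_morphism lpoly.
Proof.
split=> [|p q]; first by apply/laurentP => -[k|k]; rewrite //= coef1.
apply/laurentP => -[n|n] /=; last first.
  symmetry; apply: fsbig1 => -[i|i] _ /=; last by rewrite mul0r.
  by case E: (Negz n - Posz i) => [j|j]; rewrite ?mulr0 //; lia.
rewrite /lmul_coef (fsbigE [seq Posz k | k <- iota 0 n.+1]) //.
- rewrite coefM big_map iota_index_iota big_mkord [RHS]big_mkcond /=.
  apply: eq_bigr => k _; rewrite in_setT; congr (_ * _).
  by rewrite (_ : _ - _ = Posz (n - k)%N) //; have := ltn_ord k; lia.
- by rewrite map_inj_uniq ?iota_uniq // => i j [].
move=> [i|i] _; last by rewrite /= mul0r.
move=> /mapP nin; case E: (Posz n - Posz i) => [j|j]; rewrite /= ?mulr0 //.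
by case: nin; exists i => //; rewrite mem_iota; lia.
Qed.

HB.instance Definition _ :=
  GRing.isZmodMorphism.Build {poly K} laurent lpoly lpoly_is_zmod_morphism.
HB.instance Definition _ :=
  GRing.isMonoidMorphism.Build {poly K} laurent lpoly lpoly_is_monoid_morphism.

Lemma lpoly_inj : injective lpoly.
Proof. by move=> p q /laurentP eqpq; apply/polyP => k; apply: (eqpq (Posz k)). Qed.

Lemma lpoly_eq0 p : (lpoly p == 0) = (p == 0).
Proof. by rewrite -(rmorph0 lpoly) (inj_eq lpoly_inj). Qed.

(* Expansion of a rational fraction in powers of 1/z. *)
Definition lfrac (r : {fraction {poly K}}) : laurent :=
  lpoly \n_(repr r) / lpoly \d_(repr r).

Lemma frac_repr (r : {fraction {poly K}}) :
  r = (\n_(repr r))%:F / (\d_(repr r))%:F.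
Proof.
have d0 : (\d_(repr r))%:F != 0 :> {fraction {poly K}}.
  by rewrite tofrac_eq0 denom_ratioP.
apply: (mulIf d0); rewrite divfK //.
rewrite -{1}[r](@reprK _ _ r); unlock FracField.tofrac.
rewrite -[LHS]FracField.pi_mul; apply/eqmodP.
rewrite /= FracField.equivfE /FracField.mulf /= !numden_Ratio ?mulf_neq0 ?oner_neq0 ?denom_ratioP //.
by rewrite !mulr1 mulrC.
Qed.

Lemma lfrac_div (p q : {poly K}) : q != 0 -> lfrac (p%:F / q%:F) = lpoly p / lpoly q.
Proof.
move=> q0; rewrite /lfrac; set r := p%:F / q%:F.
have := frac_repr r; set n := \n_(repr r); set d := \d_(repr r) => /eqP.
have d0 : d != 0 by apply: denom_ratioP.
rewrite eqr_div ?tofrac_eq0 // -!tofracM tofrac_eq => /eqP e.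
by apply/eqP; rewrite eqr_div ?lpoly_eq0 // -!rmorphM -e.
Qed.

Lemma lfrac_tofrac p : lfrac p%:F = lpoly p.
Proof. by rewrite -[p%:F]divr1 -tofrac1 lfrac_div ?oner_neq0 // rmorph1 divr1. Qed.

Fact lfrac_is_zmod_morphism : zmod_morphism lfrac.
Proof.
move=> r s; rewrite [X in lfrac (X - _)]frac_repr [X in lfrac (_ - X)]frac_repr.
rewrite {2 3}/lfrac.
have := denom_ratioP (repr r); have := denom_ratioP (repr s).
move: (\n_ _) (\n_ _) (\d_ _) (\d_ _) => p q d e d0 e0.
rewrite -mulNr -mulNr addf_div ?tofrac_eq0 // addf_div ?lpoly_eq0 //.
by rewrite -tofracN -!tofracM -tofracD lfrac_div ?mulf_neq0 // rmorphD !rmorphM rmorphN.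
Qed.

Fact lfrac_is_monoid_morphism : monoid_morphism lfrac.
Proof.
split=> [|r s]; first by rewrite -tofrac1 lfrac_tofrac rmorph1.
rewrite [X in lfrac (X * _)]frac_repr [X in lfrac (_ * X)]frac_repr.
rewrite {2 3}/lfrac.
have := denom_ratioP (repr r); have := denom_ratioP (repr s).
move: (\n_ _) (\n_ _) (\d_ _) (\d_ _) => p q d e d0 e0.
by rewrite !mulf_div -!tofracM lfrac_div ?mulf_neq0 // !rmorphM.
Qed.

HB.instance Definition _ := GRing.isZmodMorphism.Build
  {fraction {poly K}} laurent lfrac lfrac_is_zmod_morphism.
HB.instance Definition _ := GRing.isMonoidMorphism.Build
  {fraction {poly K}} laurent lfrac lfrac_is_monoid_morphism.

End LaurentDef.

(* fin_cf [:: a_0; ...; a_n] = 1 / (a_0 + 1 / (a_1 + ... + 1 / a_n)). *)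
Fixpoint fin_cf (F : fieldType) (s : seq F) : F :=
  if s is a :: s' then (a + fin_cf s')^-1 else 0.

Definition CFn (K : fieldType) (a : nat -> {poly K}) (n : nat) :
    {fraction {poly K}} :=
  fin_cf [seq (a i)%:F | i <- iota 0 n.+1].

Definition CF (K : fieldType) (a : nat -> {poly K}) : laurent K :=
  llim (fun n => lfrac (CFn a n)).

Section AlgebraicDegree.
Variables (F E : fieldType) (iota : {rmorphism F -> E}).

Definition minimal_polynomial (x : E) (p : {poly F}) :=
  [/\ p \is monic, root (map_poly iota p) x
    & forall q : {poly F}, q != 0 -> root (map_poly iota q) x ->
        (size p <= size q)%N].

Definition algebraic_of_degree (x : E) (d : nat) :=
  exists2 p : {poly F}, minimal_polynomial x p & size p = d.+1.

End AlgebraicDegree.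

(* Main.v *)
Require Import Defs.
From mathcomp Require Import all_boot all_order all_algebra.
From mathcomp Require Import ring zify.
Import Order.TTheory GRing.Theory Num.Theory.
Local Open Scope ring_scope.

Set Implicit Arguments.
Unset Strict Implicit.
Unset Printing Implicit Defensive.

(**
The statement holds over every field K of characteristic 2, for any two distinct
nonconstant polynomials a and b.

Put p = a b, s = a + b, t = p^2 + s^2 and c = p t. Let P_n and Q_n be the
products of the matrices [[u, 1], [1, 0]], u running over the letters of the n-th
iterate of the substitution on a, respectively on b; then P_{n+1} = P_n Q_n and
Q_{n+1} = Q_n P_n, all determinants are 1, and the continued fraction is the limit
of the quotients of the two entries in the first column of P_n. In characteristic
2 the trace relation t_{n+1} = t_{n-1}^2 (t_n - 2) + 2 of the Thue-Morse words
becomes the purely multiplicative t_{n+1} = t_{n-1}^2 t_n. For odd n the matrix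
Q_n is the transpose of P_n, because word reversal exchanges the two iterates.
Together these facts turn P -> P Q Q P into an affine recurrence with explicit
coefficients (two_step). With T_0 = 1 and T_{m+1} = c T_m^4, the first column of
P_{2m+1}, divided by T_m, is
  p + S_{m+1} + (p / t) S_m^2   and   b + (s / t) S_m^2,
where S_m = 1 / T_0 + ... + 1 / T_{m-1}. The recurrence of T makes the
limit S of S_m satisfy c S = c + S^4, so that F = S + 1 is a root of
f = X^4 + c X + 1, and the continued fraction is
  xi = (b t + s + s F^2) / (t (p + 1) + p + t F + p F^2).

The polynomial f is irreducible over K(z): a factor of degree 1 or 2 has its
coefficients in K[z] by integral closure, its constant term is then a unit, and
this forces c to be constant (quartic_noroot, quartic_noquad). Hence F has degree
4 and xi, a rational function of F, has degree at most 4. It is not smaller: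
a Moebius transform eta of xi satisfies F^2 + eta F + v = 0 with v affine in
eta; reducing f modulo this relation gives
  (eta^3 + c) F = v^2 + eta^2 v + 1,
so F is a rational function of eta, and therefore of xi, except in degenerate
cases in which either F is affine in eta or F is quadratic over K(z)
(degree_quotient_gt3).
*)

(** * Degree of an element of a field extension *)

Section Degree.
Variables (F E : fieldType) (iota : {rmorphism F -> E}).

Definition degree_le (x : E) (d : nat) :=
  exists q : {poly F},
    [/\ q != 0, (size q <= d.+1)%N & root (map_poly iota q) x].

(** If q has degree at most d and kills x, the d + 1 polynomials
g^i h^(d - i) reduced modulo q lie in a space of dimension d, so they satisfy
a nontrivial linear relation; divided by h(x)^d it becomes a polynomial equation
of degree at most d for g(x) / h(x). Any annihilating polynomial q serves, so
the lemma applies to elements whose minimal polynomial is unknown. *)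
Lemma degree_le_rational x d (g h : {poly F}) :
  degree_le x d -> ~~ root (map_poly iota h) x ->
  degree_le ((map_poly iota g).[x] / (map_poly iota h).[x]) d.
Proof.
move=> [q [q0 szq qx]] hx; set y := _ / _.
pose f (i : nat) := g ^+ i * h ^+ (d - i).
pose A : 'M[F]_(d.+1, d) := \matrix_i poly_rV (f i %% q).
have szf i : (size (f i %% q)%R <= d)%N.
  by rewrite -ltnS; apply: leq_trans szq; rewrite ltn_modp.
have kA0 : kermx A != 0.
  by rewrite kermx_eq0 /row_free neq_ltn ltnS rank_leq_col.
pose c := nz_row (kermx A); have c0 : c != 0 by rewrite nz_row_eq0.
have cA : c *m A = 0.
  by apply/sub_kermxP; apply: nz_row_sub.
exists (rVpoly c); split.
- by rewrite -(inj_eq (can_inj (@rVpolyK _ d.+1))) raddf0 in c0.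
- exact: size_poly.
have modp_sum (s : 'I_d.+1 -> {poly F}) :
    (\sum_i s i) %% q = \sum_i (s i %% q).
  by elim/big_rec2: _ => [|i u v _ IH]; rewrite ?mod0p // modpD IH.
have qdvd : q %| \sum_(i < d.+1) c 0 i *: f i.
  rewrite /dvdp modp_sum; apply/eqP.
  transitivity (rVpoly (c *m A)); last by rewrite cA raddf0.
  rewrite mulmx_sum_row raddf_sum; apply: eq_bigr => i _ /=.
  by rewrite linearZ /= rowK poly_rV_K // modpZl.
have /dvdpP[k ek] := qdvd.
have : (map_poly iota (\sum_(i < d.+1) c 0 i *: f i)).[x] = 0.
  by rewrite ek rmorphM hornerM (rootP qx) mulr0.
have hx0 : (map_poly iota h).[x] != 0 by [].
move=> sum0; apply/rootP; apply: (mulIf (expf_neq0 d hx0)).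
rewrite mul0r -[RHS]sum0 rmorph_sum horner_sum.
rewrite (@horner_coef_wide _ d.+1); last by rewrite size_map_poly size_poly.
rewrite mulr_suml; apply: eq_bigr => i _.
rewrite coef_map coef_rVpoly_ord /= map_polyZ hornerZ -mulrA; congr (_ * _).
rewrite rmorphM !rmorphXn hornerM !horner_exp expr_div_n.
have led : (i <= d)%N by rewrite -ltnS.
have -> z : z ^+ d = z ^+ i * z ^+ (d - i) :> E by rewrite -exprD subnKC.
by rewrite mulrA divfK // expf_neq0.
Qed.

Lemma minimal_degree x d :
  degree_le x d.+1 -> ~ degree_le x d -> algebraic_of_degree iota x d.+1.
Proof.
move=> [q [q0 szq qx]] notd.
have lb (r : {poly F}) :
    r != 0 -> root (map_poly iota r) x -> (d.+1 < size r)%N.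
  by move=> r0 rx; rewrite ltnNge; apply/negP => szr; apply: notd; exists r.
have lq0 : lead_coef q != 0 by rewrite lead_coef_eq0.
have szq' : size q = d.+2 by apply/eqP; rewrite eqn_leq szq lb.
exists ((lead_coef q)^-1 *: q); last by rewrite size_scale ?invr_eq0.
split.
- by rewrite monicE lead_coefZ mulVf.
- by rewrite map_polyZ rootZ // fmorph_eq0 invr_eq0.
by move=> r r0 rx; rewrite size_scale ?invr_eq0 // szq'; apply: lb.
Qed.

End Degree.

(** * Irreducibility of X^4 + c X + 1 *)

Section IntegralClosure.
Variable K : fieldType.
Implicit Types (x : {fraction {poly K}}) (P : {poly {poly K}}).

Lemma frac_coprime x : exists p q : {poly K},
  [/\ q != 0, coprimep p q & x = p%:F / q%:F].
Proof.
have ex := frac_repr x; have d0 := denom_ratioP (repr x).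
move: (\n_(repr x)) (\d_(repr x)) ex d0 => n d -> d0.
have g0 : gcdp n d != 0 by rewrite gcdp_eq0 (negPf d0) andbF.
exists (n %/ gcdp n d), (d %/ gcdp n d); split.
- by rewrite dvdp_div_eq0 // dvdp_gcdr.
- by apply: coprimep_div_gcd; rewrite d0 orbT.
have q0 : d %/ gcdp n d != 0 by rewrite dvdp_div_eq0 // dvdp_gcdr.
apply/eqP; rewrite eqr_div ?tofrac_eq0 // -!tofracM tofrac_eq.
apply/eqP; transitivity (n %/ gcdp n d * gcdp n d * (d %/ gcdp n d)).
  by rewrite divpK ?dvdp_gcdl.
by rewrite -mulrA [gcdp n d * _]mulrC divpK ?dvdp_gcdr.
Qed.

(** K[z] is integrally closed. Clearing denominators in P(p / q) = 0 with p and q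
coprime shows that q divides a power of p, so q is a constant. *)
Lemma frac_integral x P :
  P \is monic -> root (map_poly (@FracField.tofrac _) P) x ->
  exists p : {poly K}, x = p%:F.
Proof.
move=> monP rx; have [p [q [q0 cpq ex]]] := frac_coprime x.
have tq0 : q%:F != 0 :> {fraction {poly K}} by rewrite tofrac_eq0.
pose n := (size P).-1.
have szP : size P = n.+1 by rewrite prednK // size_poly_gt0 monic_neq0.
have Pn : P`_n = 1 by apply/eqP; rewrite -monicE.
have sum0 : \sum_(i < n.+1) P`_i * p ^+ i * q ^+ (n - i) = 0.
  apply/eqP; rewrite -tofrac_eq0 rmorph_sum /=.
  apply/eqP.
  transitivity ((map_poly (@FracField.tofrac _) P).[x] * q%:F ^+ n); last first.
    by rewrite (rootP rx) mul0r.
  rewrite (@horner_coef_wide _ n.+1); last first.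
    by rewrite -szP; apply: size_poly.
  rewrite mulr_suml; apply: eq_bigr => i _.
  have lei : (i <= n)%N by rewrite -ltnS.
  rewrite coef_map /= !tofracM !tofracXn ex expr_div_n -!mulrA.
  congr (_ * (_ * _)).
  have -> z : z ^+ n = z ^+ i * z ^+ (n - i) :> {fraction {poly K}}.
    by rewrite -exprD subnKC.
  by rewrite (mulKf (expf_neq0 i tq0)).
have qdvd : q %| p ^+ n.
  move: sum0; rewrite big_ord_recr /= Pn mul1r subnn expr0 mulr1 => /eqP.
  rewrite addrC addr_eq0 => /eqP->; rewrite dvdpNr.
  apply: (big_ind (fun u => q %| u)) => [|u v qu qv|i _].
  - exact: dvdp0.
  - exact: dvdp_add.
  by apply: dvdp_mull; rewrite -(subnSK (ltn_ord i)) exprS dvdp_mulr.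
have : size q == 1%N.
  rewrite -(@coprimepp _ q); apply: (coprimep_dvdr qdvd).
  by rewrite coprimep_expl.
move=> /size_poly1P[r r0 eq1].
exists (r^-1 *: p); rewrite ex; apply: (mulIf tq0).
rewrite divfK // eq1 -tofracM.
by rewrite -mul_polyC mulrC mulrA -polyCM divff // mul1r.
Qed.

End IntegralClosure.

Lemma size_linear (R : nzRingType) (u v : R) :
  (size (u *: 'X + v%:P)%R <= 2)%N.
Proof.
rewrite -mul_polyC size_MXaddC; case: ifP => // _.
by rewrite ltnS size_polyC_leq1.
Qed.

Section Quartic.
Variable K : fieldType.
Hypothesis char2 : 2%:R = 0 :> K.

Lemma poly_char2 : 2%:R = 0 :> {poly K}.
Proof. by rewrite -polyC_natr char2. Qed.

Lemma frac_char2 : 2%:R = 0 :> {fraction {poly K}}.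
Proof. by rewrite -(rmorph_nat (@FracField.tofrac _)) poly_char2 rmorph0. Qed.

Lemma poly_mul1_const (p q : {poly K}) : p * q = 1 -> exists k, p = k%:P.
Proof.
move=> pq1; have : p \is a GRing.unit by apply/unitrPr; exists q.
by rewrite poly_unitE => /andP[/size_poly1P[k _ ->] _]; exists k.
Qed.

Variable c : {poly K}.
Hypothesis c_nonconst : (1 < size c)%N.

Let c_neqC k : c <> k%:P.
Proof. by move=> ec; move: c_nonconst; rewrite ec size_polyC; case: eqP. Qed.

Definition quartic : {poly {fraction {poly K}}} := 'X^4 + c%:F *: 'X + 1.

Lemma size_quartic : size quartic = 5.
Proof.
rewrite /quartic -addrA size_polyDl size_polyXn //.
exact: leq_ltn_trans (size_linear _ _) _.
Qed.

(** A root is integral over K[z], hence a polynomial r with r (r^3 + c) = 1: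
both factors are constants, and so is c. *)
Lemma quartic_noroot x : ~~ root quartic x.
Proof.
apply/negP => /rootP; rewrite /quartic !hornerE => rx.
have [p ep] : exists p : {poly K}, x = p%:F.
  apply: (@frac_integral _ _ ('X^4 + c *: 'X + 1)).
    rewrite monicE -addrA lead_coefDl ?lead_coefXn // size_polyXn.
    exact: leq_ltn_trans (size_linear _ _) _.
  apply/rootP; rewrite !rmorphD /= rmorph1 map_polyZ map_polyX map_polyXn.
  by rewrite !hornerE.
have e : p * (p ^+ 3 + c) = 1.
  apply/eqP; rewrite -tofrac_eq; apply/eqP.
  rewrite tofracM tofracD tofracXn tofrac1 -ep -[RHS]addr0 -rx.
  by ring: frac_char2.
have [k ek] := poly_mul1_const e; rewrite mulrC in e.
have [l el] := poly_mul1_const e.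
apply: (@c_neqC (l - k ^+ 3)); rewrite polyCB -el polyC_exp -ek; ring.
Qed.

(** The hypotheses are those on the coefficients of
X^4 + c X + 1 = (X^2 + u X + v) (X^2 + u X + w) in characteristic 2. They give
u^3 = c and v^2 + u^2 v + 1 = 0, so u and v are polynomials, and
v (v + u^2) = 1 makes v, then u^2, then c constant. *)
Lemma quartic_noquad (u v w : {fraction {poly K}}) :
  v + w = u ^+ 2 -> u * (v + w) = c%:F -> v * w = 1 -> False.
Proof.
move=> evw euc evw1.
have u3 : u ^+ 3 = c%:F by rewrite -euc evw; ring.
have [p ep] : exists p : {poly K}, u = p%:F.
  apply: (@frac_integral _ _ ('X^3 - c%:P)); first exact: monicXnsubC.
  apply/rootP; rewrite rmorphB /= map_polyXn map_polyC /= !hornerE u3; ring.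
have [q eq] : exists q : {poly K}, v = q%:F.
  apply: (@frac_integral _ _ ('X^2 + (p ^+ 2 *: 'X + 1))).
    rewrite monicE lead_coefDl ?lead_coefXn // size_polyXn.
    exact: leq_ltn_trans (size_linear _ _) _.
  apply/rootP; rewrite !rmorphD /= rmorph1 map_polyZ map_polyX map_polyXn.
  rewrite !hornerE /= tofracXn -ep -evw mulrDl [w * v]mulrC evw1.
  by ring: frac_char2.
have e : q * (q + p ^+ 2) = 1.
  apply/eqP; rewrite -tofrac_eq; apply/eqP.
  rewrite tofracM tofracD tofracXn tofrac1 -ep -eq -evw -evw1.
  by ring: frac_char2.
have [k ek] := poly_mul1_const e; rewrite mulrC in e.
have [l el] := poly_mul1_const e.
have p2 : p ^+ 2 = (l - k)%:P by rewrite polyCB -el -ek; ring.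
have szp : (size p <= 1)%N.
  have := size_exp p 2; rewrite p2 size_polyC.
  by case: (_ != 0); case: (size p) => [|[]].
have ec : c = p ^+ 3 by apply/eqP; rewrite -tofrac_eq tofracXn -ep u3.
by apply: (@c_neqC (p`_0 ^+ 3)); rewrite polyC_exp -size1_polyC.
Qed.

Lemma dvdp_quartic (g : {poly {fraction {poly K}}}) :
  g %| quartic -> (size g <= 4)%N -> (size g <= 1)%N.
Proof.
move=> /dvdpP[h ef] szg; rewrite leqNgt; apply/negP => lt1g.
have f0 : quartic != 0 by rewrite -size_poly_eq0 size_quartic.
have /norP[h0 g0] : ~~ ((h == 0) || (g == 0)) by rewrite -mulf_eq0 -ef.
have szf : (size h + size g = 6)%N.
  by have := size_quartic; rewrite ef size_mul //; case: (_ + _)%N => //= k ->.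
have nolin (l m : {poly {fraction {poly K}}}) : quartic = l * m -> size l <> 2.
  move=> elm /poly2_root[x rx]; have := quartic_noroot x.
  by rewrite elm rootM rx.
have szg2 : size g <> 2 by apply: (nolin _ h); rewrite mulrC.
have szh2 : size h <> 2 by apply: nolin ef.
have [szg3 szh3] : size g = 3 /\ size h = 3.
  by move: lt1g szg szf szg2 szh2; move: (size g) (size h) => m n; lia.
have gd i : (2 < i)%N -> g`_i = 0 by move=> lti; rewrite nth_default ?szg3.
have hd i : (2 < i)%N -> h`_i = 0 by move=> lti; rewrite nth_default ?szh3.
have E i : (h * g)`_i = (i == 4)%:R + c%:F * (i == 1)%:R + (i == 0)%:R.
  by rewrite -ef !coefD coefZ coefXn coefX coef1.
have := E 4; have := E 3; have := E 2; have := E 1; have := E 0.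
rewrite !coefM !big_ord_recl !big_ord0 /= /bump /= !subn0 /=.
rewrite !subSS /= ?subn0 !(gd 3, gd 4, hd 3, hd 4) //.
rewrite !(mulr0, mul0r, addr0, add0r, mulr1).
set h2 := h`_2; set h1 := h`_1; set h0' := h`_0.
set g2 := g`_2; set g1 := g`_1; set g0' := g`_0.
move=> E0 E1 E2 E3 E4.
have E3' : h1 * g2 = h2 * g1.
  by rewrite -[LHS]addr0 -E3; ring: frac_char2.
have E2' : h2 * g0' + h0' * g2 = h1 * g1.
  by rewrite -[LHS]addr0 -E2; ring: frac_char2.
(* g and h have to be made monic; as h2 is the inverse of g2, g is multiplied
   by h2 and h by g2. *)
apply: (@quartic_noquad (g1 * h2) (g0' * h2) (h0' * g2)).
- rewrite [g0' * h2]mulrC E2' expr2 {2}[g1 * h2]mulrC -E3'.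
  by transitivity (h1 * g1 * (h2 * g2)); [rewrite E4 mulr1 | ring].
- have -> : g1 * h2 * (g0' * h2 + h0' * g2) =
    (h2 * g1) * g0' * h2 + g1 * h0' * (h2 * g2) by ring.
  rewrite -E3' E4 mulr1 -E1 addrC; congr (_ + _); first exact: mulrC.
  by transitivity (h1 * g0' * (h2 * g2)); [ring | rewrite E4 mulr1].
- transitivity ((h0' * g0') * (h2 * g2)); first by ring.
  by rewrite E0 E4 mulr1.
Qed.

Lemma quartic_degree (E : fieldType)
    (iota : {rmorphism {fraction {poly K}} -> E}) x :
  root (map_poly iota quartic) x -> ~ degree_le iota x 3.
Proof.
move=> fx [q [q0 szq qx]]; have szg := dvdp_quartic (dvdp_gcdl quartic q).
have gx : root (map_poly iota (gcdp quartic q)) x.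
  by rewrite gcdp_map root_gcd fx.
have g0 : gcdp quartic q != 0 by rewrite gcdp_eq0 (negPf q0) andbF.
have /szg : (size (gcdp quartic q) <= 4)%N.
  by apply: leq_trans szq; apply: dvdp_leq => //; apply: dvdp_gcdr.
move=> /size1_polyC eg; move: gx g0; rewrite eg map_polyC rootC /= fmorph_eq0.
by move=> /eqP->; rewrite eqxx.
Qed.

End Quartic.

(** * Rational functions of degree 2 of a quartic element *)

Section QuotientOfQuadratics.
Variables (L E : fieldType) (iota : {rmorphism L -> E}).
Hypothesis char2 : 2%:R = 0 :> L.
Variables (c s p t n0 d0 : L) (F xi : E).
Hypothesis s0 : s != 0.
Hypothesis t0 : t != 0.
Hypothesis F4 : F ^+ 4 + iota c * F + 1 = 0.
Hypothesis F_degree : ~ degree_le iota F 3.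

Let D := iota d0 + iota t * F + iota p * F ^+ 2.
Let N := iota n0 + iota s * F ^+ 2.
Hypothesis xiD : xi * D = N.

Let char2E : 2%:R = 0 :> E.
Proof. by rewrite -(rmorph_nat iota) char2 rmorph0. Qed.

Let horner_map := (rmorphD, rmorphM, rmorphXn, rmorph1,
  map_polyZ, map_polyC, map_polyX, map_polyXn, hornerE).

(* 1, F and F^2 are linearly independent over L. *)
Let not_quadratic (u v w : L) : (u, v) != (0, 0) ->
  iota u * F ^+ 2 + iota v * F + iota w <> 0.
Proof.
move=> uv0 Fq; apply: F_degree.
exists (u *: 'X^2 + (v *: 'X + w%:P)); split.
- apply: contra_neq uv0 => /polyP q0; congr (_, _).
    by have := q0 2; rewrite !coefE /= !(mulr0, mulr1, addr0).
  by have := q0 1; rewrite !coefE /= !(mulr0, mulr1, addr0, add0r).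
- apply: leq_trans (size_polyD _ _) _; rewrite geq_max.
  rewrite (leq_trans (size_scale_leq _ _)) ?size_polyXn //.
  exact: leq_trans (size_linear _ _) _.
by apply/rootP; rewrite !horner_map /= ?horner_map /= -Fq; ring.
Qed.

Let D0 : D != 0.
Proof.
apply/eqP => eD; apply: (@not_quadratic p t d0); last by rewrite -eD /D; ring.
by rewrite xpair_eqE (negPf t0) andbF.
Qed.

Lemma degree_quotient_le4 : degree_le iota xi 4.
Proof.
have FX : degree_le iota F 4.
  exists ('X^4 + (c *: 'X + 1)); split.
  - rewrite -size_poly_gt0 size_polyDl size_polyXn //.
    exact: leq_ltn_trans (size_linear _ _) _.
  - rewrite size_polyDl size_polyXn //.
    exact: leq_ltn_trans (size_linear _ _) _.
  by apply/rootP; rewrite !horner_map /= ?horner_map /= -F4; ring.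
have eD : (map_poly iota (d0%:P + t *: 'X + p *: 'X^2)).[F] = D.
  by rewrite !horner_map /= ?horner_map /= /D; ring.
have eN : (map_poly iota (n0%:P + s *: 'X^2)).[F] = N.
  by rewrite !horner_map /= ?horner_map /= /N; ring.
have -> : xi = N / D by rewrite -xiD mulfK.
by rewrite -eN -eD; apply: degree_le_rational FX _; rewrite /root eD.
Qed.

(** Suppose that xi has degree at most 3. Replacing the denominator D by
D + (p / s) N removes the term in F^2, so the Moebius transform eta of xi equals
(F^2 + n) / (F + m). Thus F is quadratic over the field generated by eta, and
eliminating F^2 from F^4 + c F + 1 = 0 leaves an equation linear in F. If
eta^3 + c is nonzero, F is a rational function of eta, so it has degree at most
3. Otherwise eta^3 = c and (n + m^2) eta^2 lies in the base field: if
n = m^2 then eta = F + m, else eta = c / eta^2 is itself in the base field and F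
is quadratic. Every case contradicts the degree of F. *)
Lemma degree_quotient_gt3 : ~ degree_le iota xi 3.
Proof.
move=> xi3; set n := n0 / s; set m := (d0 + p * n0 / s) / t.
have is0 : iota s != 0 by rewrite fmorph_eq0.
have it0 : iota t != 0 by rewrite fmorph_eq0.
have eDN : (iota s + iota p * xi) * D = iota s * iota t * (F + iota m).
  rewrite mulrDl -mulrA xiD /N /D /m !(rmorphM, rmorphD, fmorphV) /=.
  by field: char2E; rewrite it0.
have Fm0 : F + iota m != 0.
  apply/eqP => eF; apply: (@not_quadratic 0 1 m).
    by rewrite xpair_eqE oner_eq0 andbF.
  by rewrite -eF rmorph0 rmorph1; ring.
have den0 : iota s + iota p * xi != 0.
  apply: contra_eq_neq eDN => ->; rewrite mul0r eq_sym.
  by rewrite !mulf_neq0.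
pose eta := iota t * xi / (iota s + iota p * xi).
have eta3 : degree_le iota eta 3.
  have eden : (map_poly iota (s%:P + p *: 'X)).[xi] = iota s + iota p * xi.
    by rewrite !horner_map /= ?horner_map /=; ring.
  have -> : eta = (map_poly iota (t *: 'X)).[xi] /
      (map_poly iota (s%:P + p *: 'X)).[xi].
    by rewrite eden !horner_map /= ?horner_map.
  by apply: degree_le_rational xi3 _; rewrite /root eden.
have eta_eq : eta * (F + iota m) = F ^+ 2 + iota n.
  apply: (mulfI (mulf_neq0 is0 it0)).
  transitivity (eta * ((iota s + iota p * xi) * D)); first by rewrite eDN; ring.
  rewrite mulrA divfK // -mulrA xiD /N /n rmorphM fmorphV /=.
  by field.
(* From here on, n and m are arbitrary elements of L related to eta by eta_eq. *)
clearbody n m eta.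
pose v := iota n + iota m * eta.
have F2 : F ^+ 2 = eta * F + v.
  transitivity (eta * (F + iota m) + iota n).
    by rewrite eta_eq; ring: char2E.
  by rewrite /v; ring: char2E.
have eF : (eta ^+ 3 + iota c) * F = v ^+ 2 + eta ^+ 2 * v + 1.
  have F4' : F ^+ 4 = eta ^+ 3 * F + eta ^+ 2 * v + v ^+ 2.
    transitivity ((F ^+ 2) ^+ 2); first by ring.
    rewrite F2; transitivity (eta ^+ 2 * F ^+ 2 + v ^+ 2).
      by ring: char2E.
    by rewrite F2; ring.
  by rewrite -[LHS]addr0 -F4 F4'; ring: char2E.
have [eta_c|eta_c] := eqVneq (eta ^+ 3 + iota c) 0; last first.
  apply: F_degree.
  pose g := (n%:P + m *: 'X) ^+ 2 + 'X^2 * (n%:P + m *: 'X) + 1.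
  pose h := 'X^3 + c%:P.
  have eh : (map_poly iota h).[eta] = eta ^+ 3 + iota c.
    by rewrite !horner_map /= ?horner_map /=; ring.
  have eg : (map_poly iota g).[eta] = v ^+ 2 + eta ^+ 2 * v + 1.
    by rewrite /g !horner_map /= ?horner_map /= ?/v; ring.
  have -> : F = (map_poly iota g).[eta] / (map_poly iota h).[eta].
    by rewrite eg eh -eF mulrC mulKf.
  by apply: degree_le_rational eta3 _; rewrite /root eh.
have ec : eta ^+ 3 = iota c by rewrite -[RHS]add0r -eta_c; ring: char2E.
have er : iota (n + m ^+ 2) * eta ^+ 2 = iota (n ^+ 2 + 1 + m * c).
  have : v ^+ 2 + eta ^+ 2 * v + 1 = 0 by rewrite -eF eta_c mul0r.
  rewrite !(rmorphD, rmorphM, rmorphXn, rmorph1) -ec /v => e.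
  by rewrite -[LHS]addr0 -e; ring: char2E.
have [k0|k0] := eqVneq (n + m ^+ 2) 0.
  apply: F_degree; have -> : F = (map_poly iota ('X + m%:P)).[eta].
    rewrite !horner_map /= ?horner_map /=.
    have -> : eta = F + iota m.
      apply: (mulIf Fm0); rewrite eta_eq -[LHS]addr0 -(rmorph0 iota) -k0.
      by rewrite rmorphD rmorphXn; ring: char2E.
    by ring: char2E.
  have e1 : (map_poly iota 1).[eta] = 1 by rewrite rmorph1 hornerC.
  rewrite -[X in degree_le _ X _]divr1 -[X in _ / X]e1.
  by apply: degree_le_rational eta3 _; rewrite /root e1 oner_eq0.
pose r := (n ^+ 2 + 1 + m * c) / (n + m ^+ 2).
have eta2 : eta ^+ 2 = iota r.
  have ik0 : iota (n + m ^+ 2) != 0 by rewrite fmorph_eq0.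
  by apply: (mulfI ik0); rewrite er /r -rmorphM [_ * (_ / _)]mulrC divfK.
have eeta : eta = iota (c / r).
  have [r0|r0] := eqVneq r 0.
    apply/eqP; rewrite r0 invr0 mulr0 rmorph0 -sqrf_eq0 eta2 r0 rmorph0 //.
  have ir0 : iota r != 0 by rewrite fmorph_eq0.
  by apply: (mulIf ir0); rewrite -rmorphM divfK // -ec -eta2; ring.
apply: (@not_quadratic 1 (c / r) (n + m * (c / r))).
  by rewrite xpair_eqE oner_eq0.
rewrite rmorph1 [iota (n + _)]rmorphD [iota (m * _)]rmorphM -eeta F2 /v.
by ring: char2E.
Qed.

Lemma degree_quotient : algebraic_of_degree iota xi 4.
Proof. exact: minimal_degree degree_quotient_le4 degree_quotient_gt3. Qed.

End QuotientOfQuadratics.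

(** * Degree and convergence of Laurent series in 1/z *)

Section LaurentTopology.
Variable K : fieldType.
Implicit Types (x y l : laurent K) (u v : nat -> laurent K) (N M : int).

Lemma lcoefD x y i : lcoef (x + y) i = lcoef x i + lcoef y i.
Proof. by []. Qed.

Lemma lcoefN x i : lcoef (- x) i = - lcoef x i.
Proof. by []. Qed.

Lemma lboundD x y N : lbound x N -> lbound y N -> lbound (x + y) N.
Proof. by move=> xN yN i Ni; rewrite lcoefD xN ?yN ?addr0. Qed.

Lemma lboundN x N : lbound x N -> lbound (- x) N.
Proof. by move=> xN i Ni; rewrite lcoefN xN ?oppr0. Qed.

Lemma lboundM x y N M : lbound x N -> lbound y M -> lbound (x * y) (N + M).
Proof. exact: lbound_mul. Qed.

Definition has_degree x N := lbound x N /\ lcoef x N != 0.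

Lemma ex_has_degree x : x != 0 -> exists N, has_degree x N.
Proof.
move=> x0; have [N xN] := lcoef_bounded x; rewrite -/(lbound x N) in xN.
have exk : exists k : nat, lcoef x (N - k%:Z) != 0.
  apply: boolp.contrapT => nex; case/eqP: x0; apply: (@lext _ N) => // m.
  by apply/eqP/negPn/negP => xm; case: nex; exists m.
case: (ex_minnP exk) => k xk kmin; exists (N - k%:Z); split=> // i ltdi.
have [ltNi|leiN] := ltP N i; first exact: xN.
apply/eqP/negPn/negP => xi; have := kmin `|(N - i)%R|%N.
have -> : N - `|(N - i)%R|%N%:Z = i by lia.
by move/(_ xi); lia.
Qed.

Lemma has_degreeM x y N M :
  has_degree x N -> has_degree y M -> has_degree (x * y) (N + M).
Proof.
move=> [xN x0] [yM y0]; split; first exact: lboundM.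
have := lmul_coefE 0 xN yM; rewrite subr0 big_ord1 subr0 subn0 /= subr0.
by rewrite -[lmul_coef x y _]/(lcoef (x * y) _) => ->; rewrite mulf_neq0.
Qed.

Lemma has_degree_neq0 x N : has_degree x N -> x != 0.
Proof. by move=> [_]; apply: contra_neq => ->. Qed.

(** The inverse has some degree, and degrees add up to the degree 0 of 1. *)
Lemma lboundV x N : has_degree x N -> lbound x^-1 (- N).
Proof.
move=> dx; have x0 := has_degree_neq0 dx.
have [M dM] : exists M, has_degree x^-1 M.
  by apply: ex_has_degree; rewrite invr_eq0.
have [d1 d2] := has_degreeM dx dM; move: d1 d2; rewrite divff // => d1 d2.
suff -> : - N = M by case: dM.
have [lt0|gt0|] := ltgtP (N + M) 0; last by lia.
  by have /eqP := d1 _ lt0; rewrite /= oner_eq0.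
by move: d2; rewrite /= gt_eqF // eqxx.
Qed.

Lemma has_degree_lpoly (p : {poly K}) :
  p != 0 -> has_degree (lpoly p) (size p).-1%:Z.
Proof.
move=> p0; split; last by rewrite /= -/(lead_coef p) lead_coef_eq0.
move=> [k|k] //= ltk; rewrite nth_default //.
by move: ltk; move: (size p) => n; lia.
Qed.

Lemma has_degreeDl x y N M :
  M < N -> has_degree x N -> lbound y M -> has_degree (x + y) N.
Proof.
move=> ltMN [xN x0] yM; split.
  by apply: lboundD => //; apply: lboundW yM; apply: ltW.
by rewrite lcoefD yM // addr0.
Qed.

Lemma lcvgP u l : lcvg u l <->
  forall N, exists n0, forall n, (n0 <= n)%N -> lbound (u n - l) N.
Proof.
split=> ul N.
  have [n0 un] := ul (N + 1); exists n0 => n /un e i lti.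
  by rewrite lcoefD lcoefN e ?subrr //; lia.
have [n0 un] := ul (N - 1); exists n0 => n /un e i lti.
by apply/eqP; rewrite -subr_eq0 -lcoefN -lcoefD e //; lia.
Qed.

Lemma lcvg_cst l : lcvg (fun=> l) l.
Proof. by move=> N; exists 0. Qed.

Lemma lcvgD u v l l' :
  lcvg u l -> lcvg v l' -> lcvg (fun n => u n + v n) (l + l').
Proof.
move=> ul vl' N; have [n un] := ul N; have [m vm] := vl' N.
exists (maxn n m) => k; rewrite geq_max => /andP[/un uk /vm vk] i lei.
by rewrite !lcoefD uk ?vk.
Qed.

Lemma lcvgM u v l l' :
  lcvg u l -> lcvg v l' -> lcvg (fun n => u n * v n) (l * l').
Proof.
move=> /lcvgP ul /lcvgP vl'; apply/lcvgP => N.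
have [B [lB l'B]] := ex_lbound2 l l'.
pose C := Num.min 0 (Num.min N (N - B)).
have [n un] := ul C; have [m vm] := vl' C.
exists (maxn n m) => k; rewrite geq_max => /andP[/un uk /vm vk].
have -> : u k * v k - l * l' =
  (u k - l) * (v k - l') + ((u k - l) * l' + l * (v k - l')) by ring.
apply: lboundD; last apply: lboundD.
- by apply: lboundW (lboundM uk vk); rewrite /C; lia.
- by apply: lboundW (lboundM uk l'B); rewrite /C; lia.
by apply: lboundW (lboundM lB vk); rewrite /C; lia.
Qed.

Lemma lcvgX u l n : lcvg u l -> lcvg (fun k => u k ^+ n) (l ^+ n).
Proof.
move=> ul; elim: n => [|n IHn]; first exact: lcvg_cst.
rewrite exprS; have := lcvgM ul IHn.
by congr lcvg; apply: boolp.funext => k; rewrite exprS.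
Qed.

Lemma lcvg_subseq u l (phi : nat -> nat) : (forall n, (n <= phi n)%N) ->
  lcvg u l -> lcvg (u \o phi) l.
Proof.
move=> phi_ge ul N; have [n0 un] := ul N.
by exists n0 => n len; apply: un; apply: leq_trans len _.
Qed.

(** The coefficient of z^i no longer changes from index |i| + 1 on. *)
Lemma lcvg_complete u : (forall n, lbound (u n.+1 - u n) (- n%:Z)) ->
  exists l, lcvg u l.
Proof.
move=> uC.
have st n m i : (n <= m)%N -> - n%:Z < i -> lcoef (u m) i = lcoef (u n) i.
  move=> lenm lti; rewrite -(subnKC lenm).
  elim: (m - n)%N => [|k IHk]; first by rewrite addn0.
  rewrite -IHk addnS; apply/eqP; rewrite -subr_eq0 -lcoefN -lcoefD uC //; lia.
pose f i := lcoef (u `|i|%N.+1) i.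
have fb : exists N, forall i, N < i -> f i = 0.
  have [N uN] := lcoef_bounded (u 0).
  exists (Num.max 0 N) => i; rewrite gt_max => /andP[i0 Ni].
  by rewrite /f (st 0 `|i|%N.+1 i) ?uN // oppr0.
exists (Laurent fb) => N; exists `|N|%N.+1 => n len i lei; rewrite /= /f.
have [le|/ltnW le] := leqP n `|i|%N.+1.
  by rewrite -(st n `|i|%N.+1 i) //; lia.
by rewrite (st `|i|%N.+1 n i) //; lia.
Qed.

End LaurentTopology.

(** * Convergence of continued fractions *)

Section ContinuedFractions.
Variable K : fieldType.
Implicit Types (s t : seq {poly K}).

Lemma fin_cf_lbound s : all (fun p : {poly K} => 1 < size p)%N s ->
  lbound (fin_cf (map (@lpoly K) s)) (-1).
Proof.
elim: s => [|p s IHs] //= /andP[szp /IHs szs].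
have p0 : p != 0 by rewrite -size_poly_gt0 ltnW.
have := lboundV (has_degreeDl _ (has_degree_lpoly p0) szs).
have lt0 : -1 < (size p).-1%:Z by [].
move/(_ lt0); apply: lboundW; move: szp; move: (size p) => n; lia.
Qed.

(** The map x -> 1 / (p + x) contracts: the difference of two values is the
difference of the arguments divided by two series of positive degree. The bound
is not sharp, as each partial quotient gains at least 2, but it suffices. *)
Lemma fin_cf_cat_lbound s t : all (fun p : {poly K} => 1 < size p)%N (s ++ t) ->
  lbound (fin_cf (map (@lpoly K) (s ++ t)) - fin_cf (map (@lpoly K) s))
    (- (size s)%:Z).
Proof.
elim: s => [|p s IHs].
  by move=> /fin_cf_lbound h; rewrite subr0; apply: lboundW h.
rewrite cat_cons /= => /andP[szp szst].
have szs : all (fun p : {poly K} => 1 < size p)%N s.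
  by move: szst; rewrite all_cat => /andP[].
have p0 : p != 0 by rewrite -size_poly_gt0 ltnW.
have lt0 : -1 < (size p).-1%:Z by [].
have d1 := has_degreeDl lt0 (has_degree_lpoly p0) (fin_cf_lbound szst).
have d2 := has_degreeDl lt0 (has_degree_lpoly p0) (fin_cf_lbound szs).
have {IHs} IHs := IHs szst.
move: (fin_cf (map _ (s ++ t))) (fin_cf (map _ s)) d1 d2 IHs => x y d1 d2 IHs.
have -> : (lpoly p + x)^-1 - (lpoly p + y)^-1 =
    - (x - y) * (lpoly p + x)^-1 * (lpoly p + y)^-1.
  by field; rewrite !(has_degree_neq0 d1, has_degree_neq0 d2).
apply: lboundW (lboundM (lboundM (lboundN IHs) (lboundV d1)) (lboundV d2)).
by move: szp; move: (size p) => n; lia.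
Qed.

Lemma rmorph_fin_cf (F E : fieldType) (f : {rmorphism F -> E}) (s : seq F) :
  f (fin_cf s) = fin_cf (map f s).
Proof.
by elim: s => [|x s IHs] /=; rewrite ?rmorph0 // fmorphV rmorphD IHs.
Qed.

Lemma lfrac_CFn (a : nat -> {poly K}) n :
  lfrac (CFn a n) = fin_cf (map (@lpoly K) [seq a i | i <- iota 0 n.+1]).
Proof.
rewrite /CFn (rmorph_fin_cf (@lfrac K)) -!map_comp; congr fin_cf.
by apply: eq_map => i /=; rewrite lfrac_tofrac.
Qed.

Lemma CF_cvg (a : nat -> {poly K}) : (forall n, 1 < size (a n))%N ->
  lcvg (fun n => lfrac (CFn a n)) (CF a).
Proof.
move=> sza; have [l al] : exists l, lcvg (fun n => lfrac (CFn a n)) l.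
  apply: lcvg_complete => n; rewrite !lfrac_CFn -[n.+2]addn1 iotaD map_cat.
  have := @fin_cf_cat_lbound [seq a i | i <- iota 0 n.+1]
    [seq a i | i <- iota (0 + n.+1) 1].
  rewrite size_map size_iota => H; apply: lboundW (H _); first by lia.
  by rewrite -map_cat all_map; apply/allP => i _ /=.
by rewrite /CF (lcvg_lim al).
Qed.

End ContinuedFractions.

(** * Matrices of the Thue-Morse words *)

Definition mx2 (R : nzRingType) (x y w v : R) : 'M[R]_2 :=
  \matrix_(i, j) if i == 0 then if j == 0 then x else y
                 else if j == 0 then w else v.

Lemma mx2M (R : nzRingType) (x y w v x' y' w' v' : R) :
  mx2 x y w v * mx2 x' y' w' v' =
  mx2 (x * x' + y * w') (x * y' + y * v') (w * x' + v * w') (w * y' + v * v').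
Proof.
apply/matrixP => i j; rewrite !mxE !big_ord_recl big_ord0 !mxE addr0 /=.
by case: (i == 0); case: (j == 0).
Qed.

Section Continuants.
Variable K : fieldType.
Implicit Types (u v : seq {poly K}).

Definition cf_matrix u : 'M[{poly K}]_2 := \prod_(p <- u) mx2 p 1 1 0.

Lemma cf_matrix_cat u v : cf_matrix (u ++ v) = cf_matrix u * cf_matrix v.
Proof. exact: big_cat. Qed.

(** The comparison of sizes added to the induction hypothesis is what keeps
the denominator from vanishing. *)
Lemma cf_matrix_fin_cf u (M := cf_matrix u) :
  all (fun p : {poly K} => 1 < size p)%N u ->
  M 0 0 != 0 /\ fin_cf (map (@lpoly K) u) = lpoly (M 1 0) / lpoly (M 0 0).
Proof.
move=> szu; suff [lt -> //] : (size (M 1 0)%R < size (M 0 0)%R)%N /\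
    fin_cf (map (@lpoly K) u) = lpoly (M 1 0) / lpoly (M 0 0).
  by split=> //; rewrite -size_poly_gt0; apply: leq_ltn_trans lt.
rewrite {}/M; elim: u szu => [_|p u IHu /= /andP[szp /IHu[lt ->]]].
  by rewrite /cf_matrix big_nil !mxE /= size_poly0 size_poly1 rmorph0 mul0r.
have -> : cf_matrix (p :: u) = mx2 p 1 1 0 * cf_matrix u.
  by rewrite /cf_matrix big_cons.
move: (cf_matrix u) lt => M lt.
have M0 : M 0 0 != 0 by rewrite -size_poly_gt0; apply: leq_ltn_trans lt.
have p0 : p != 0 by rewrite -size_poly_gt0 ltnW.
have -> : (mx2 p 1 1 0 * M) 0 0 = p * M 0 0 + M 1 0.
  rewrite !mxE !big_ord_recl big_ord0 !mxE /= addr0 mul1r.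
  by congr (_ + M _ _); apply: val_inj.
have -> : (mx2 p 1 1 0 * M) 1 0 = M 0 0.
  by rewrite !mxE !big_ord_recl big_ord0 !mxE /= !addr0 mul1r mul0r addr0.
have lt2 : (size (M 0 0)%R < size (p * M 0 0)%R)%N.
  rewrite size_mul //; move: szp.
  have: (0 < size (M 0 0)%R)%N by rewrite size_poly_gt0.
  by move: (size p) (size (M 0 0)%R) => k l; lia.
have szD : size (p * M 0 0 + M 1 0) = size (p * M 0 0).
  by rewrite size_polyDl //; apply: ltn_trans lt2.
split; first by rewrite szD.
rewrite rmorphD rmorphM.
rewrite -[X in (X + _)^-1](@mulfK _ (lpoly (M 0 0))) ?lpoly_eq0 //.
by rewrite -mulrDl invfM invrK mulrC.
Qed.

End Continuants.

Section Words.
Variables (T : eqType) (a b : T).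

Definition tm_word n x := iter n (word_subst a b) [:: x].

Lemma tm_wordS n : b != a ->
  tm_word n.+1 a = tm_word n a ++ tm_word n b /\
  tm_word n.+1 b = tm_word n b ++ tm_word n a.
Proof.
move=> ba; have cat u v : iter n (word_subst a b) (u ++ v) =
    iter n (word_subst a b) u ++ iter n (word_subst a b) v.
  by elim: n => //= n ->; rewrite word_subst_cat.
rewrite /tm_word !iterSr -!cat /word_subst /= /tm_subst eqxx (negPf ba).
by [].
Qed.

Lemma thue_morse_prefix n :
  [seq thue_morse a b i | i <- iota 0 (2 ^ n)] = tm_word n a.
Proof.
rewrite -[RHS](mkseq_nth a) /tm_word size_iter_word_subst /mkseq.
apply/eq_in_map => i; rewrite mem_iota => /andP[_ lti].
by rewrite (@thue_morseE _ _ _ n).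
Qed.

Lemma tm_word_letters n : all (mem [:: a; b]) (tm_word n a).
Proof.
elim: n => [|n IHn]; first by rewrite /= inE eqxx.
rewrite /tm_word iterS -/(tm_word n a).
elim: (tm_word n a) IHn => //= x w IHw /andP[_ /IHw].
rewrite all_cat => ->; rewrite andbT /tm_subst.
by case: ifP => _ /=; rewrite !inE !eqxx ?orbT.
Qed.

End Words.

Lemma exprD4_char2 (R : comNzRingType) (u v : R) : 2%:R = 0 :> R ->
  (u + v) ^+ 4 = u ^+ 4 + v ^+ 4.
Proof.
move=> char2; have sq (u' v' : R) : (u' + v') ^+ 2 = u' ^+ 2 + v' ^+ 2.
  by ring: char2.
by rewrite !(exprM _ 2 2) !sq.
Qed.

(** The substitution applied twice sends P to P Q Q P and Q to Q P P Q. The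
letters x and y stand for the first row of P, T for the product of the traces of
the previous words; Q is the transpose of P, the trace of P is p T and the sum of
its off-diagonal entries is s T. These four properties are inherited, with
T' = c T^4 in place of T, and the new first row is affine in the old one because
products of entries are eliminated by means of det P = 1: writing
A = x^2 + y^2 and r = s x + p y, this relation makes A affine in x and y, and
A^2 affine in A and r^2. *)
Section TwoStep.
Variable R : comNzRingType.
Hypothesis char2 : 2%:R = 0 :> R.
Variables p s T x y : R.
Hypothesis det1 : x * (x + p * T) + y * (y + s * T) = 1.

Let c := p * (p ^+ 2 + s ^+ 2).
Let T' := c * T ^+ 4.
Let x' := c * T ^+ 3 * x + 1 + p ^+ 2 * T ^+ 2.
Let y' := c * T ^+ 3 * y + p * s * T ^+ 2.
Let P := mx2 x y (y + s * T) (x + p * T).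
Let Q := mx2 x (y + s * T) y (x + p * T).

Let A := x ^+ 2 + y ^+ 2.
Let r := s * x + p * y.

(* The coefficient 3 occurs when A^2 is replaced in the last entry. *)
Let three : 3%:R = 1 :> R.
Proof. by rewrite -natr1 char2 add0r. Qed.

Let linA : A = 1 + T * (p * x + s * y).
Proof. by rewrite /A -det1; ring: char2. Qed.

Let sqA : A ^+ 2 = 1 + T ^+ 2 * (p ^+ 2 + s ^+ 2) * A + T ^+ 2 * r ^+ 2.
Proof.
transitivity (1 + T ^+ 2 * (p * x + s * y) ^+ 2).
  by rewrite linA; ring: char2.
by rewrite /A /r; ring: char2.
Qed.

Let PQ : P * Q = mx2 A (T * r) (T * r) (A + (p ^+ 2 + s ^+ 2) * T ^+ 2).
Proof. by rewrite mx2M /A /r; congr mx2; ring: char2. Qed.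

Let QP : Q * P = mx2 (A + s ^+ 2 * T ^+ 2) (T * r + s * p * T ^+ 2)
  (T * r + s * p * T ^+ 2) (A + p ^+ 2 * T ^+ 2).
Proof. by rewrite mx2M /A /r; congr mx2; ring: char2. Qed.

Let x'E : x' = 1 + p ^+ 2 * T ^+ 2 * A + s * p * T ^+ 3 * r.
Proof. by rewrite /x' linA /c /r; ring: char2. Qed.

Let y'E : y' = s * p * T ^+ 2 * A + p ^+ 2 * T ^+ 3 * r.
Proof. by rewrite /y' linA /c /r; ring: char2. Qed.

Lemma two_step : P * Q * (Q * P) = mx2 x' y' (y' + s * T') (x' + p * T').
Proof.
rewrite PQ QP mx2M x'E y'E /T' /c; move: (A) (r) sqA => A0 r0 sq.
by congr mx2; ring: sq char2 three.
Qed.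

Lemma two_step_rev : Q * P * (P * Q) = mx2 x' (y' + s * T') y' (x' + p * T').
Proof.
rewrite PQ QP mx2M x'E y'E /T' /c; move: (A) (r) sqA => A0 r0 sq.
by congr mx2; ring: sq char2 three.
Qed.

Lemma det_mx2 (u v w z : R) : \det (mx2 u v w z) = u * z - v * w.
Proof.
rewrite (expand_det_row _ ord0) !big_ord_recl big_ord0.
by rewrite /cofactor !det_mx11 !mxE /=; ring.
Qed.

Lemma two_step_det : x' * (x' + p * T') + y' * (y' + s * T') = 1.
Proof.
have opp (z : R) : - z = z.
  apply/eqP; rewrite eq_sym -addr_eq0.
  by rewrite -mulr2n -mulr_natr char2 mulr0.
have dP : \det P = 1 by rewrite det_mx2 opp det1.
have dQ : \det Q = 1 by rewrite det_mx2 opp [_ * y]mulrC det1.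
have := congr1 determinant two_step.
by rewrite !det_mulmx dP dQ !mulr1 det_mx2 opp => <-.
Qed.

End TwoStep.

(** * The quartic equation and the degree *)

Section Main.
Variable K : fieldType.
Hypothesis char2 : 2%:R = 0 :> K.
Variables a b : {poly K}.
Hypotheses (sza : (1 < size a)%N) (szb : (1 < size b)%N) (ab : b != a).

Let char2p := poly_char2 char2.

Let char2l : 2%:R = 0 :> laurent K.
Proof. by rewrite -(rmorph_nat (@lpoly K)) char2p rmorph0. Qed.

Let p := a * b.
Let s := a + b.
Let t := p ^+ 2 + s ^+ 2.
Let c := p * t.

Let s0 : s != 0.
Proof.
apply: contra_neq ab => s0; rewrite -[RHS]addr0 -s0 /s.
by ring: char2p.
Qed.

(* deg (a + b) < deg a + deg b since neither is constant. *)
Let size_ps : size (p + s) = size p.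
Proof.
apply: size_polyDl; apply: leq_ltn_trans (size_polyD _ _) _.
have a0 : a != 0 by rewrite -size_poly_gt0 ltnW.
have b0 : b != 0 by rewrite -size_poly_gt0 ltnW.
rewrite size_mul //; move: sza szb; move: (size a) (size b) => m n; lia.
Qed.

Let size_p : (1 < size p)%N.
Proof.
have a0 : a != 0 by rewrite -size_poly_gt0 ltnW.
have b0 : b != 0 by rewrite -size_poly_gt0 ltnW.
rewrite size_mul //; move: sza szb; move: (size a) (size b) => m n; lia.
Qed.

Let p0 : p != 0. Proof. by rewrite -size_poly_gt0 ltnW. Qed.

Let t0 : t != 0.
Proof.
have -> : t = (p + s) ^+ 2 by rewrite /t; ring: char2p.
by rewrite expf_neq0 // -size_poly_gt0 size_ps ltnW.
Qed.

Let size_c : (1 < size c)%N.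
Proof.
rewrite size_mul //; have : (0 < size t)%N by rewrite size_poly_gt0.
by move: size_p; move: (size p) (size t) => m n; lia.
Qed.

Let c0 : c != 0. Proof. by rewrite mulf_neq0. Qed.

(** The product of the traces of the words tm_word 1 a, ..., tm_word (2 m) a. *)
Fixpoint tprod m : {poly K} := if m is m'.+1 then c * tprod m' ^+ 4 else 1.

(** This entry and the next form the first row of the matrix of
tm_word (2 m + 1) a. *)
Fixpoint diag_entry m : {poly K} :=
  if m is m'.+1 then
    c * tprod m' ^+ 3 * diag_entry m' + 1 + p ^+ 2 * tprod m' ^+ 2
  else p + 1.

Fixpoint off_entry m : {poly K} :=
  if m is m'.+1 then c * tprod m' ^+ 3 * off_entry m' + p * s * tprod m' ^+ 2
  else a.

Let x m := diag_entry m.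
Let y m := off_entry m.
Let w m := y m + s * tprod m.
Let v m := x m + p * tprod m.

Lemma tm_matrix m :
  [/\ cf_matrix (tm_word a b m.*2.+1 a) = mx2 (x m) (y m) (w m) (v m),
      cf_matrix (tm_word a b m.*2.+1 b) = mx2 (x m) (w m) (y m) (v m)
    & x m * v m + y m * w m = 1].
Proof.
elim: m => [|m [IHa IHb IHd]].
  have [-> ->] := tm_wordS 0 ab.
  rewrite /cf_matrix /= !big_cons !big_nil !mulr1 !mx2M.
  have -> : v 0 = 1 by rewrite /v /x /=; ring: char2p.
  have -> : w 0 = b by rewrite /w /y /= /s; ring: char2p.
  rewrite /x /y /= /p; split; last by ring: char2p.
    by congr mx2; ring.
  by congr mx2; ring.
have [ea eb] := tm_wordS m.*2.+2 ab; have [ea' eb'] := tm_wordS m.*2.+1 ab.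
rewrite doubleS ea eb ea' eb' !cf_matrix_cat IHa IHb.
split; first exact: two_step; first exact: two_step_rev.
exact: two_step_det.
Qed.

Lemma size_tprod m : (m < size (tprod m))%N.
Proof.
elim: m => [|m IHm]; first by rewrite size_poly1.
have T0 : tprod m != 0 by rewrite -size_poly_gt0; apply: leq_ltn_trans IHm.
rewrite /= size_mul ?expf_neq0 //.
have : (0 < size (tprod m ^+ 4)%R)%N by rewrite size_poly_gt0 expf_neq0.
have := size_exp (tprod m) 4; have := size_c; move: IHm.
by move: (size (tprod m)) (size (tprod m ^+ 4)%R) (size c) => i j k; lia.
Qed.

Let T0 m : tprod m != 0.
Proof. by rewrite -size_poly_gt0; apply: leq_ltn_trans (size_tprod m). Qed.

(** The partial sums S_m of the series of 1 / T_j. *)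
Definition inv_sum m : laurent K := \sum_(j < m) (lpoly (tprod j))^-1.

Lemma inv_sumS m : inv_sum m.+1 = inv_sum m + (lpoly (tprod m))^-1.
Proof. exact: big_ord_recr. Qed.

Lemma inv_sum_cvg : exists l, lcvg inv_sum l.
Proof.
apply: lcvg_complete => m; rewrite inv_sumS addrC addKr.
apply: lboundW (lboundV (has_degree_lpoly (T0 m))).
by have := size_tprod m; move: (size _) => n; lia.
Qed.

(** Raising to the fourth power is additive, and 1 / T_{j+1} = (1 / T_j)^4 / c. *)
Lemma inv_sum_quartic m :
  lpoly c * inv_sum m.+1 = lpoly c + inv_sum m ^+ 4.
Proof.
have ic0 : lpoly c != 0 by rewrite lpoly_eq0.
elim: m => [|m IHm].
  by rewrite inv_sumS /inv_sum big_ord0 /= rmorph1 invr1 add0r; ring.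
rewrite inv_sumS mulrDr IHm inv_sumS /=.
rewrite [lpoly (c * _)]rmorphM /= [lpoly (_ ^+ 4)]rmorphXn /=.
rewrite invfM mulVKf // -exprVn.
by rewrite -addrA -exprD4_char2.
Qed.

(** Divided by T_{m+1} = p t T_m^4, the recurrence of two_step becomes
x_{m+1} / T_{m+1} = x_m / T_m + 1 / T_{m+1} + (p / t) / T_m^2, and the sum of
the 1 / T_j^2 is the square of the sum of the 1 / T_j. *)
Lemma diag_entry_inv_sum m :
  lpoly (x m) / lpoly (tprod m) =
  lpoly p + inv_sum m.+1 + lpoly p / lpoly t * inv_sum m ^+ 2.
Proof.
have it0 : lpoly t != 0 by rewrite lpoly_eq0.
have ip0 : lpoly p != 0 by rewrite lpoly_eq0.
elim: m => [|m IHm].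
  by rewrite inv_sumS /inv_sum big_ord0 /x /= rmorphD /= rmorph1 invr1; ring.
have iT0 : lpoly (tprod m) != 0 by rewrite lpoly_eq0.
transitivity (lpoly (x m) / lpoly (tprod m) + (lpoly (tprod m.+1))^-1
    + lpoly p / lpoly t * (lpoly (tprod m))^-1 ^+ 2).
  (* p, t, T_m and x_m are replaced by independent variables. *)
  have step (q r u z : {poly K}) :
      lpoly q != 0 -> lpoly r != 0 -> lpoly u != 0 ->
      lpoly (q * r * u ^+ 3 * z + 1 + q ^+ 2 * u ^+ 2)
        / lpoly (q * r * u ^+ 4) =
      lpoly z / lpoly u + (lpoly (q * r * u ^+ 4))^-1
        + lpoly q / lpoly r * (lpoly u)^-1 ^+ 2.
    move=> q0 r0 u0; rewrite !(rmorphD, rmorphM, rmorphXn, rmorph1) /=.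
    by field; rewrite q0 r0 u0.
  exact: step.
rewrite IHm !inv_sumS; ring: char2l.
Qed.

Lemma off_entry_inv_sum m :
  lpoly (w m) / lpoly (tprod m) = lpoly b + lpoly s / lpoly t * inv_sum m ^+ 2.
Proof.
have it0 : lpoly t != 0 by rewrite lpoly_eq0.
have ip0 : lpoly p != 0 by rewrite lpoly_eq0.
elim: m => [|m IHm].
  rewrite /inv_sum big_ord0 /w /y /= rmorph1 invr1 !mulr1.
  have -> : a + s = b by rewrite /s; ring: char2p.
  by ring.
have iT0 : lpoly (tprod m) != 0 by rewrite lpoly_eq0.
transitivity (lpoly (w m) / lpoly (tprod m)
    + lpoly s / lpoly t * (lpoly (tprod m))^-1 ^+ 2).
  have step (q r u o z : {poly K}) :
      lpoly q != 0 -> lpoly r != 0 -> lpoly u != 0 ->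
      lpoly (q * r * u ^+ 3 * z + q * o * u ^+ 2 + o * (q * r * u ^+ 4))
        / lpoly (q * r * u ^+ 4) =
      lpoly (z + o * u) / lpoly u + lpoly o / lpoly r * (lpoly u)^-1 ^+ 2.
    move=> q0 r0 u0; rewrite !(rmorphD, rmorphM, rmorphXn) /=.
    by field; rewrite q0 r0 u0.
  exact: step.
rewrite IHm !inv_sumS; ring: char2l.
Qed.

Lemma thue_morse_letter i : thue_morse a b i = a \/ thue_morse a b i = b.
Proof.
have : thue_morse a b i \in [:: a; b].
  apply: (allP (tm_word_letters a b i)); apply: mem_nth.
  by rewrite size_iter_word_subst ltn_expl.
by rewrite !inE => /orP[] /eqP; [left|right].
Qed.

Lemma size_thue_morse i : (1 < size (thue_morse a b i))%N.
Proof. by case: (thue_morse_letter i) => ->. Qed.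

(** tm_word (2 m + 1) a has 2^(2 m + 1) letters, and CFn a n uses n + 1 partial
quotients. *)
Lemma CFn_entries m :
  x m != 0 /\
  lfrac (CFn (thue_morse a b) (2 ^ m.*2.+1).-1) = lpoly (w m) / lpoly (x m).
Proof.
rewrite lfrac_CFn prednK ?expn_gt0 // thue_morse_prefix.
have [eM _ _] := tm_matrix m.
have := @cf_matrix_fin_cf K (tm_word a b m.*2.+1 a).
rewrite eM /= !mxE /=; apply.
rewrite -[X in all _ X]/(tm_word a b m.*2.+1 a) -thue_morse_prefix all_map.
by apply/allP => i _; apply: size_thue_morse.
Qed.

(** The limit is taken in the identity convergent times denominator equals
numerator, along the indices of CFn_entries; that the limit of the denominators
is nonzero comes later, from the degree of F. *)
Lemma CF_thue_morse : exists sigma : laurent K,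
  lpoly c * sigma = lpoly c + sigma ^+ 4 /\
  CF (thue_morse a b) * (lpoly p + sigma + lpoly p / lpoly t * sigma ^+ 2) =
  lpoly b + lpoly s / lpoly t * sigma ^+ 2.
Proof.
have [l Sl] := inv_sum_cvg; exists l.
have SlS : lcvg (fun m => inv_sum m.+1) l.
  by apply: (@lcvg_subseq _ inv_sum l succn) => // n.
split.
  apply: (@lcvg_unique _ (fun m => lpoly c * inv_sum m.+1)).
    exact: lcvgM (lcvg_cst _) SlS.
  have := lcvgD (lcvg_cst (lpoly c)) (lcvgX 4 Sl).
  by congr lcvg; apply: boolp.funext => m; rewrite inv_sum_quartic.
pose phi m := (2 ^ m.*2.+1).-1.
have phi_ge m : (m <= phi m)%N.
  rewrite -ltnS prednK ?expn_gt0 //.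
  by apply: ltn_trans (ltn_expl m.*2.+1 _) => //; lia.
have CFl := lcvg_subseq phi_ge (CF_cvg size_thue_morse).
have xl := lcvgD (lcvgD (lcvg_cst (lpoly p)) SlS)
  (lcvgM (lcvg_cst (lpoly p / lpoly t)) (lcvgX 2 Sl)).
apply: (lcvg_unique (lcvgM CFl xl)).
have := lcvgD (lcvg_cst (lpoly b))
  (lcvgM (lcvg_cst (lpoly s / lpoly t)) (lcvgX 2 Sl)).
congr lcvg; apply: boolp.funext => m /=.
rewrite -diag_entry_inv_sum -off_entry_inv_sum.
have [x0 ->] := CFn_entries m.
have ix0 : lpoly (x m) != 0 by rewrite lpoly_eq0.
by rewrite mulrA (divfK ix0).
Qed.

Theorem CF_thue_morse_degree4 :
  algebraic_of_degree (@lfrac K) (CF (thue_morse a b)) 4.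
Proof.
have [l [lc lCF]] := CF_thue_morse.
have it0 : lpoly t != 0 by rewrite lpoly_eq0.
have F4 : (l + 1) ^+ 4 + lpoly c * (l + 1) + 1 = 0.
  by rewrite mulrDr lc exprD4_char2 //; ring: char2l.
apply: (@degree_quotient _ _ _ (frac_char2 char2) c%:F s%:F p%:F t%:F
  (b * t + s)%:F (t * (p + 1) + p)%:F (l + 1)).
- by rewrite tofrac_eq0.
- by rewrite tofrac_eq0.
- by rewrite /= lfrac_tofrac.
- apply: (quartic_degree char2 size_c); apply/rootP.
  rewrite /quartic !rmorphD /= rmorph1 map_polyXn map_polyZ map_polyX /=.
  by rewrite !hornerE lfrac_tofrac -F4; ring.
have expand (q r u o : {poly K}) :
    (lpoly (r * (q + 1) + q) = lpoly r * (lpoly q + 1) + lpoly q) *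
    (lpoly (u * r + o) = lpoly u * lpoly r + lpoly o).
  by rewrite !(rmorphD, rmorphM, rmorph1).
rewrite /= !lfrac_tofrac (expand p t b s).1 (expand p t b s).2.
move: (CF _) (lpoly p) (lpoly s) (lpoly b) (lpoly t) it0 lCF.
move=> xi P S B T it0 lCF.
transitivity (T * (xi * (P + l + P / T * l ^+ 2))).
  have -> : T * (xi * (P + l + P / T * l ^+ 2)) =
      xi * (T * (P + l) + P * l ^+ 2) by field.
  by ring: char2l.
rewrite lCF; have -> : T * (B + S / T * l ^+ 2) = B * T + S * l ^+ 2 by field.
by ring: char2l.
Qed.

End Main.

Theorem mainTheorem1 (a b : {poly 'F_2})
    (ha : (1 < size a)%N) (hb : (1 < size b)%N) (hab : a <> b)
    (hdeg : ((size a).-1 + (size b).-1 <= 7)%N) :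
  algebraic_of_degree (@lfrac 'F_2) (CF (thue_morse a b)) 4.
Proof.
apply: CF_thue_morse_degree4 => //; first exact: val_inj.
by rewrite eq_sym; apply/eqP.
Qed.
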